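(* Let $\mathcal{G}$ be a noncompact tree (a noncompact metric graph containing no cycles) with nonempty compact core $\mathcal{K}$ and with at most one pendant. Then for every $p>2$ and every $\mu>0$ there is no bound state of mass $\mu$ (for the NLS equation on $\mathcal{G}$ with nonlinearity localized on $\mathcal{K}$ and Kirchhoff conditions) with $\lambda\le 0$.
   Context: Metric graphs. A metric graph $\mathcal{G}$ is a connected multigraph (multiple edges and self-loops allowed) with finitely many edges; each edge $e$ is identified either with a bounded interval $I_e=[0,\ell_e]$, $\ell_e>0$ (bounded edge, coordinate $x_e$ with arbitrary orientation), or with $I_e=[0,+\infty)$ (half-line, attached to the graph at its vertex $x_e=0$; the point at infinity is not a vertex), the edges being joined at their endpoints, the vertices. $\mathcal{G}$ is noncompact if and only if it contains at least one half-line. The compact core $\mathcal{K}$ is the metric subgraph consisting of all bounded edges. A pendant is a bounded edge incident at a vertex of degree one (a half-line is never a pendant). A tree is a metric graph that contains no cycles (in particular no self-loops and no multiple edges between the same vertices). Function spaces. A function $u:\mathcal{G}\to\mathbb{C}$ is a family $\{u_e\}$ with $u_e:I_e\to\mathbb{C}$. $\|u\|_{L^p(\mathcal{G})}^p=\sum_e\|u_e\|_{L^p(I_e)}^p$. $H^1(\mathcal{G})$ is the space of continuous $u:\mathcal{G}\to\mathbb{C}$ (components agree at common vertices) with $u_e\in H^1(I_e;\mathbb{C})$ for every edge $e$. For $\mu>0$, $H^1_\mu(\mathcal{G})=\{u\in H^1(\mathcal{G}):\|u\|_{L^2(\mathcal{G})}^2=\mu\}$. Bound states. Let $\kappa:\mathcal{G}\to\{0,1\}$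 be the characteristic function of $\mathcal{K}$ and $p>2$. A bound state of mass $\mu$ is a function $u\in H^1_\mu(\mathcal{G})$ for which there is $\lambda\in\mathbb{R}$ (the Lagrange multiplier of $u$) such that $u_e''+\kappa(x)|u_e|^{p-2}u_e=\lambda u_e$ on every edge $e$, and $\sum_{e\succ \mathrm{v}}\frac{du_e}{dx_e}(\mathrm{v})=0$ for every vertex $\mathrm{v}\in\mathcal{K}$ (Kirchhoff condition), where the sum is over all edges incident at $\mathrm{v}$ and $\frac{du_e}{dx_e}(\mathrm{v})$ is $u_e'(0)$ or $-u_e'(\ell_e)$ according to whether $x_e$ equals $0$ or $\ell_e$ at $\mathrm{v}$. *)

(* Defs.v *)
From HB Require Import structures.
From mathcomp Require Import all_boot all_order all_algebra.
From mathcomp Require Import all_classical all_reals all_analysis.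
From mathcomp Require Import complex.

Set Implicit Arguments.
Unset Strict Implicit.
Unset Printing Implicit Defensive.

Import Order.TTheory GRing.Theory Num.Theory.
Import numFieldNormedType.Exports.

Local Open Scope classical_set_scope.
Local Open Scope complex_scope.
Local Open Scope ring_scope.

(* [source e] and [target e] are the vertices of the bounded edge [e] at
   x_e = 0 and x_e = len e; [base h] is the vertex of the half-line [h] at
   x_h = 0.  Half-lines join no two vertices, so connectedness only involves
   the bounded edges. *)
Record metric_graph (R : realType) := MetricGraph {
  vertex : finType;
  bedge : finType;
  hline : finType;
  source : bedge -> vertex;
  target : bedge -> vertex;
  base : hline -> vertex;
  len : bedge -> R;
  len_gt0 : forall e, 0 < len e;
  connected_graph : forall v w : vertex,
    connect (fun x y => [exists e, ((source e == x) && (target e == y))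
                                || ((source e == y) && (target e == x))]) v w
}.

Section Graph.
Context {R : realType} (G : metric_graph R).

Definition edge : finType := (bedge G + hline G)%type.

Definition noncompact : Prop := (0 < #|hline G|)%N.

Definition core_nonempty : Prop := (0 < #|bedge G|)%N.

Definition in_core (v : vertex G) : bool :=
  [exists e, (source e == v) || (target e == v)].

(* A self-loop contributes 2 to the degree of its vertex. *)
Definition degree (v : vertex G) : nat :=
  (#|[set e : bedge G | source e == v]%SET|
   + #|[set e : bedge G | target e == v]%SET|
   + #|[set h : hline G | base h == v]%SET|)%N.

Definition pendant (e : bedge G) : bool :=
  (degree (source e) == 1%N) || (degree (target e) == 1%N).

(* An oriented bounded edge; the boolean tells whether it is traversed from
   target to source. *)
Definition dart : Type := (bedge G * bool)%type.
Definition dart_from (d : dart) : vertex G :=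
  if d.2 then target d.1 else source d.1.
Definition dart_to (d : dart) : vertex G :=
  if d.2 then source d.1 else target d.1.

(* Length 1 gives the self-loops and length 2 the pairs of parallel edges. *)
Definition is_cycle (s : seq dart) : bool :=
  [&& s != [::], cycle (fun d d' => dart_to d == dart_from d') s,
      uniq [seq dart_from d | d <- s] & uniq [seq d.1 | d <- s]].

Definition is_tree : Prop := forall s : seq dart, ~~ is_cycle s.

Definition edge_dom (e : edge) : set R :=
  match e with
  | inl b => `[0, len b]%classic
  | inr _ => `[0, +oo[%classic
  end.

(* The value of the characteristic function of the compact core at interior
   points of [e]. *)
Definition kappa (e : edge) : R :=
  match e with inl _ => 1 | inr _ => 0 end.

End Graph.

Section Intervals.
Context {R : realType}.
Implicit Types (D : set R) (f g phi : R -> R) (u : R -> R[i]).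

Definition re u : R -> R := fun x => complex.Re (u x).
Definition im u : R -> R := fun x => complex.Im (u x).

Definition test_function D phi : Prop :=
  (forall n x, derivable (derive1n n phi) x 1) /\
  exists K : set R,
    [/\ compact K, K `<=` interior D & forall x, ~ K x -> phi x = 0].

Definition is_L2 D f : Prop :=
  measurable_fun D f /\
  (\int[lebesgue_measure]_(x in D) ((f x) ^+ 2)%:E < +oo)%E.

Definition weak_derivative D f g : Prop :=
  forall phi, test_function D phi ->
    \int[lebesgue_measure]_(x in D) (f x * derive1 phi x) =
    - \int[lebesgue_measure]_(x in D) (g x * phi x).

Definition is_H1 D f : Prop :=
  is_L2 D f /\ exists2 g, is_L2 D g & weak_derivative D f g.

Definition is_H1C D u : Prop := is_H1 D (re u) /\ is_H1 D (im u).

Definition continuousC_on D u : Prop :=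
  {within D, continuous (re u)} /\ {within D, continuous (im u)}.

Definition derivableC u (x : R) : Prop :=
  derivable (re u) x 1 /\ derivable (im u) x 1.

Definition deriveC u : R -> R[i] :=
  fun x => derive1 (re u) x +i* derive1 (im u) x.

Definition right_derivative u (a : R) (d : R[i]) : Prop :=
  (fun h => (re u (a + h) - re u a) / h) @ 0^'+ --> complex.Re d /\
  (fun h => (im u (a + h) - im u a) / h) @ 0^'+ --> complex.Im d.

Definition left_derivative u (a : R) (d : R[i]) : Prop :=
  (fun h => (re u (a + h) - re u a) / h) @ 0^'- --> complex.Re d /\
  (fun h => (im u (a + h) - im u a) / h) @ 0^'- --> complex.Im d.

End Intervals.

Section BoundStates.
Context {R : realType} (G : metric_graph R).
(* Only the values of [u e] on [edge_dom e] are meaningful. *)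
Implicit Types (u : edge G -> R -> R[i]).

Definition continuous_on_graph u : Prop :=
  (forall e, continuousC_on (edge_dom e) (u e)) /\
  exists U : vertex G -> R[i],
    [/\ forall b : bedge G, u (inl b) 0 = U (source b),
        forall b : bedge G, u (inl b) (len b) = U (target b) &
        forall h : hline G, u (inr h) 0 = U (base h)].

Definition H1_graph u : Prop :=
  continuous_on_graph u /\ forall e, is_H1C (edge_dom e) (u e).

Definition mass u : \bar R :=
  (\sum_(e : edge G)
     \int[lebesgue_measure]_(x in edge_dom e)
        ((ComplexField.Normc.normc (u e x)) ^+ 2)%:E)%E.

Definition H1_mass (mu : R) u : Prop := H1_graph u /\ mass u = mu%:E.

(* Imposed at interior points only: at a vertex lying on a half-line the
   characteristic function of the core differs from [kappa]. *)
Definition nls_equation (p lambda : R) u : Prop :=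
  forall (e : edge G) (x : R), interior (edge_dom e) x ->
    [/\ derivableC (u e) x, derivableC (deriveC (u e)) x &
        deriveC (deriveC (u e)) x
        + (kappa e * (ComplexField.Normc.normc (u e x)) `^ (p - 2))%:C * u e x
        = lambda%:C * u e x].

(* [d0 e] is u_e'(0) and [d1 b] is u_b'(len b). *)
Definition kirchhoff u : Prop :=
  exists (d0 : edge G -> R[i]) (d1 : bedge G -> R[i]),
    [/\ forall e, right_derivative (u e) 0 (d0 e),
        forall b, left_derivative (u (inl b)) (len b) (d1 b) &
        forall v : vertex G, in_core v ->
          \sum_(b : bedge G | source b == v) d0 (inl b)
          + \sum_(b : bedge G | target b == v) (- d1 b)
          + \sum_(h : hline G | base h == v) d0 (inr h) = 0].

Definition bound_state (p mu lambda : R) u : Prop :=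
  [/\ H1_mass mu u, nls_equation p lambda u & kirchhoff u].

End BoundStates.

(* Main.v *)
Require Import Defs.
From mathcomp Require Import all_boot all_order all_algebra.
From mathcomp Require Import all_classical all_reals all_analysis.
From mathcomp Require Import complex ring lra measurable_realfun.

Set Implicit Arguments.
Unset Strict Implicit.
Unset Printing Implicit Defensive.

Import Order.TTheory GRing.Theory Num.Theory.
Import numFieldNormedType.Exports.
Local Open Scope classical_set_scope.
Local Open Scope ring_scope.

(** On a half-line the equation is the linear one, u'' = lambda u, and for
lambda <= 0 its nonzero solutions are oscillating or affine, hence not square
integrable (L2_halfline_eq0). So a bound state with lambda <= 0 vanishes on all
half-lines; by continuity and the Kirchhoff condition this information is
passed on to the compact core.

On a bounded edge a bound state solves u'' = q u with a bounded real q, so it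
vanishes identically as soon as u and its derivative vanish at one end. This is
obtained from a Gronwall estimate for f^2 + f'^2 (energy_gronwall), and the
small values of that energy near the end come from the mean value theorem
(energy_small_at_end). Consequently, at a vertex of degree at least two, if all
incident edges but one carry the zero function, so does the last one
(kirchhoff_leaf_eq0).

Assume that u is nonzero on some bounded edge. The edges where it is nonzero
form a forest, and by the propagation principle a leaf of that forest has no
other incident edge or half-line at all: it is a vertex of degree one, and its
edge is a pendant. A nonempty forest has two leaves joined by a path
(tree_leaf), and there is at most one pendant, so both leaves are the ends of
one edge. By connectedness the graph is then that edge alone
(single_edge_compact), contrary to the presence of a half-line. Hence u = 0,
and its mass is 0. *)

(** * Uniqueness for linear second order equations *)

Section Calculus.
Context {R : realType}.
Implicit Types (f g df d2f : R -> R) (a b x y z : R).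

Lemma is_derive_within_continuous g dg a b :
  (forall z, a <= z <= b -> is_derive z 1 g (dg z)) ->
  {within `[a, b], continuous g}.
Proof.
move=> dgP; apply: derivable_within_continuous => z; rewrite in_itv /= => zab.
by have := dgP z zab => -[].
Qed.

Lemma is_derive_le0_nincr g dg a b : a <= b ->
  (forall z, a <= z <= b -> is_derive z 1 g (dg z)) ->
  (forall z, a <= z <= b -> dg z <= 0) -> g b <= g a.
Proof.
move=> ab dgP dg0.
have [||c cab E] := @MVT_segment _ g dg a b ab.
- by move=> z; rewrite in_itv /= => /andP[az zb]; apply: dgP; rewrite !ltW.
- exact: is_derive_within_continuous dgP.
by rewrite -subr_le0 E mulr_le0_ge0 ?subr_ge0 ?dg0 //; rewrite in_itv in cab.
Qed.

Lemma is_derive_eq0_cst g dg a b : a <= b ->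
  (forall z, a <= z <= b -> is_derive z 1 g (dg z)) ->
  (forall z, a <= z <= b -> dg z = 0) -> g b = g a.
Proof.
move=> ab dgP dg0.
have [||c cab E] := @MVT_segment _ g dg a b ab.
- by move=> z; rewrite in_itv /= => /andP[az zb]; apply: dgP; rewrite !ltW.
- exact: is_derive_within_continuous dgP.
by apply/eqP; rewrite -subr_eq0 E dg0 ?mul0r //; rewrite in_itv in cab.
Qed.

Definition energy f df x := f x ^+ 2 + df x ^+ 2.

(** The derivative of E = f^2 + f'^2 is at most (1 + C) E in absolute value, so
E times exp(-(1 + C) x) decreases and E times exp((1 + C) x) increases.
Stated in both directions so that the Cauchy data may be prescribed at either
end of an edge. *)
Lemma energy_gronwall f df d2f C a b : 0 <= C -> a <= b ->
  (forall z, a <= z <= b -> is_derive z 1 f (df z)) ->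
  (forall z, a <= z <= b -> is_derive z 1 df (d2f z)) ->
  (forall z, a <= z <= b -> `|d2f z| <= C * `|f z|) ->
  energy f df b <= energy f df a * expR ((1 + C) * (b - a)) /\
  energy f df a <= energy f df b * expR ((1 + C) * (b - a)).
Proof.
move=> C0 ab fP dfP d2fP; set M := 1 + C.
pose dE z := 2 * f z * df z + 2 * df z * d2f z.
have dEP z : a <= z <= b -> is_derive z 1 (energy f df) (dE z).
  move=> zab; have := fP z zab; have := dfP z zab => H1 H2.
  rewrite /energy; apply: is_derive_eq.
  by rewrite /dE /GRing.scale /=; ring.
have dEM z : a <= z <= b -> `|dE z| <= M * energy f df z.
  move=> zab; have := d2fP z zab; rewrite /dE /energy /M => H.
  have A : `|2 * f z * df z| <= f z ^+ 2 + df z ^+ 2.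
    have := sqr_ge0 (f z - df z); have := sqr_ge0 (f z + df z).
    by rewrite ler_norml => ? ?; apply/andP; split; lra.
  have B : `|2 * df z * d2f z| <= C * (f z ^+ 2 + df z ^+ 2).
    rewrite -(real_normK (num_real (f z))) -(real_normK (num_real (df z))).
    rewrite !normrM normr_nat.
    have := normr_ge0 (df z); have := normr_ge0 (f z).
    have := mulr_ge0 C0 (sqr_ge0 (`|f z| - `|df z|)).
    by have := ler_wpM2l (normr_ge0 (df z)) H; lra.
  by apply: (le_trans (ler_normD _ _)); lra.
have EP s z : a <= z <= b -> is_derive z 1
    (fun t => energy f df t * expR (s * t))
    ((dE z + s * energy f df z) * expR (s * z)).
  move=> zab; have := dEP z zab => H.
  apply: is_derive_eq.
  by rewrite /GRing.scale /=; ring.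
split.
- have : energy f df b * expR (- M * b) <= energy f df a * expR (- M * a).
    apply: is_derive_le0_nincr ab (EP (- M)) _ => z zab.
    rewrite pmulr_lle0 ?expR_gt0 //.
    by have := dEM z zab; rewrite ler_norml; lra.
  move=> H; rewrite mulrBr expRD mulrA mulrAC -ler_pdivrMr ?expR_gt0 //.
  by rewrite -!expRN -!mulNr.
have : - (energy f df b * expR (M * b)) <= - (energy f df a * expR (M * a)).
  apply: (is_derive_le0_nincr (g := fun t => - (energy f df t * expR (M * t)))
     ab) => [z zab|z zab].
    by have := EP M z zab => H; apply: is_derive_eq.
  have := dEM z zab; rewrite ler_norml => H.
  by rewrite oppr_le0 pmulr_lge0 ?expR_gt0 //; lra.
rewrite lerN2 => H; rewrite mulrBr expRD mulrA expRN.
by rewrite ler_pdivlMr ?expR_gt0.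
Qed.

(** Uniqueness with Cauchy data prescribed as a limit: the equation holds
only in the interior, where f' need not extend to the ends, so smallness of the
energy is asked at some interior points instead of at an end. *)
Lemma small_energy_eq0 f df d2f C a b : 0 <= C ->
  (forall z, a < z < b -> is_derive z 1 f (df z)) ->
  (forall z, a < z < b -> is_derive z 1 df (d2f z)) ->
  (forall z, a < z < b -> `|d2f z| <= C * `|f z|) ->
  (forall e, 0 < e -> exists2 s, a < s < b & energy f df s < e) ->
  forall x, a < x < b -> f x = 0.
Proof.
move=> C0 fP dfP d2fP small x xab; apply/eqP; apply: contraT => fx0.
have fx2 : 0 < f x ^+ 2 by rewrite exprn_even_gt0.
set K := expR ((1 + C) * (b - a)).
have [|s sab sE] := small (f x ^+ 2 / K); first by rewrite divr_gt0 ?expR_gt0.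
have seg u v z : a < u < b -> a < v < b -> u <= z <= v -> a < z < b.
  move=> /andP[au ub] /andP[av vb] /andP[uz zv].
  by rewrite (lt_le_trans au uz) (le_lt_trans zv vb).
suff : energy f df x <= energy f df s * K.
  rewrite ltr_pdivlMr ?expR_gt0 // in sE.
  by rewrite /energy in sE *; have := sqr_ge0 (df x); lra.
have Es : 0 <= energy f df s by rewrite addr_ge0 ?sqr_ge0.
have KM u v : a < u < b -> a < v < b -> expR ((1 + C) * (v - u)) <= K.
  move=> /andP[au ub] /andP[av vb]; rewrite ler_expR ler_wpM2l //; lra.
have [sx|/ltW xs] := leP s x.
- have [|||+ _] := @energy_gronwall f df d2f C s x C0 sx.
  + by move=> z zI; apply: fP; apply: seg zI.
  + by move=> z zI; apply: dfP; apply: seg zI.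
  + by move=> z zI; apply: d2fP; apply: seg zI.
  move=> /le_trans; apply; apply: ler_wpM2l => //; exact: KM.
have [|||_ +] := @energy_gronwall f df d2f C x s C0 xs.
+ by move=> z zI; apply: fP; apply: seg zI.
+ by move=> z zI; apply: dfP; apply: seg zI.
+ by move=> z zI; apply: d2fP; apply: seg zI.
move=> /le_trans; apply; apply: ler_wpM2l => //; exact: KM.
Qed.

(** The mean value theorem produces points where f' is as small as a
difference quotient at the end c; that the derivative exists and vanishes at c
is enough, and no continuity of f' up to c has to be proved. *)
Lemma energy_small_at_end f df a b c : a < b ->
  {within `[a, b], continuous f} ->
  (forall z, a < z < b -> is_derive z 1 f (df z)) ->
  c = a \/ c = b -> f c = 0 ->
  (forall d, 0 < d -> exists2 r, 0 < r &
     forall x, a < x < b -> `|x - c| < r -> `|f x| <= d * `|x - c|) ->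
  forall e, 0 < e -> exists2 s, a < s < b & energy f df s < e.
Proof.
move=> ab cf fP cE fc0 f'c e e0.
(* d <= 1 and d <= e / 4 give d^2 <= e / 4 for each of the two squares *)
pose d := Num.min 1 (e / 4).
have d0 : 0 < d by rewrite lt_min ltr01 divr_gt0.
have d1 : d <= 1 by rewrite ge_min lexx.
have de : d <= e / 4 by rewrite ge_min lexx orbT.
have [r r0 Hr] := f'c d d0.
pose h := Num.min r (Num.min (b - a) 1) / 2.
have m0 : 0 < Num.min r (Num.min (b - a) 1).
  by rewrite !lt_min r0 ltr01 subr_gt0 ab.
have h0 : 0 < h by rewrite divr_gt0.
have mr : Num.min r (Num.min (b - a) 1) <= r by rewrite ge_min lexx.
have mba : Num.min r (Num.min (b - a) 1) <= b - a by rewrite !ge_min lexx orbT.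
have m1 : Num.min r (Num.min (b - a) 1) <= 1 by rewrite !ge_min lexx !orbT.
have [hr hba h1] : [/\ h < r, h < b - a & h <= 1] by rewrite /h; split; lra.
have [u [v [uv au vb vu nearc]]] : exists u v, [/\ u < v, a <= u, v <= b,
    `|f v - f u| <= d * (v - u) &
    forall s, u < s < v -> `|s - c| < r /\ `|s - c| <= 1].
  case: cE => cE; rewrite {}cE in fc0 Hr *.
    exists a, (a + h); rewrite fc0 subr0 addrAC subrr add0r; split; try lra.
      have := Hr (a + h); rewrite addrAC subrr add0r gtr0_norm //; apply; lra.
    by move=> s /andP[as_ sh]; rewrite gtr0_norm; lra.
  exists (b - h), b; rewrite fc0 sub0r normrN opprB subrKC; split; try lra.
    have := Hr (b - h); rewrite addrAC subrr add0r normrN gtr0_norm //; apply; lra.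
  by move=> s /andP[as_ sh]; rewrite ltr0_norm; lra.
have [||s sI E] := @MVT _ f df u v uv.
- by move=> z; rewrite in_itv /= => /andP[az zh]; apply: fP; lra.
- apply: continuous_subspaceW cf => z; rewrite /= !in_itv /=; lra.
move: sI; rewrite in_itv /= => sI; have sab : a < s < b by lra.
have [sr s1] := nearc s sI.
exists s => //.
have fs : `|f s| <= d.
  by apply: (le_trans (Hr s sab sr)); rewrite ler_piMr // ltW.
have dfs : `|df s| <= d.
  by move: vu; rewrite E normrM (@gtr0_norm _ (v - u)) ?subr_gt0 // ler_pM2r ?subr_gt0.
have sq w : `|w| <= d -> w ^+ 2 <= e / 4.
  move=> wd; rewrite -real_normK ?num_real // expr2.
  by have := normr_ge0 w; nra.
have := sq _ fs; have := sq _ dfs; rewrite /energy; lra.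
Qed.

Lemma right_derivative_flat f a : f a = 0 ->
  (fun h => (f (a + h) - f a) / h) @ 0^'+ --> (0 : R) ->
  forall d, 0 < d -> exists2 r, 0 < r &
    forall x, a < x -> `|x - a| < r -> `|f x| <= d * `|x - a|.
Proof.
move=> fa0 /cvgrPdist_lt f'a d /f'a; rewrite near_withinE => -[/= r r0 Hr].
exists r => // x ax xr; have := Hr (x - a).
rewrite /ball_ /= !sub0r !normrN subrKC fa0 subr0 normrM normfV subr_gt0.
by move=> /(_ xr ax)/ltW; rewrite ler_pdivrMr // normr_gt0 subr_eq0 gt_eqF.
Qed.

Lemma left_derivative_flat f b : f b = 0 ->
  (fun h => (f (b + h) - f b) / h) @ 0^'- --> (0 : R) ->
  forall d, 0 < d -> exists2 r, 0 < r &
    forall x, x < b -> `|x - b| < r -> `|f x| <= d * `|x - b|.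
Proof.
move=> fb0 /cvgrPdist_lt f'b d /f'b; rewrite near_withinE => -[/= r r0 Hr].
exists r => // x xb xr; have := Hr (x - b).
rewrite /ball_ /= !sub0r !normrN subrKC fb0 subr0 normrM normfV subr_lt0.
by move=> /(_ xr xb)/ltW; rewrite ler_pdivrMr // normr_gt0 subr_eq0 lt_eqF.
Qed.

Lemma within_continuous_bounded f a b : a <= b ->
  {within `[a, b], continuous f} ->
  exists2 B : R, 0 <= B & forall x, a <= x <= b -> `|f x| <= B.
Proof.
move=> ab cf.
have [c _ cP] := EVT_max ab cf.
have [c' _ cP'] := EVT_min ab cf.
exists (`|f c| + `|f c'|) => [|x xab]; first by rewrite addr_ge0.
have xI : x \in `[a, b]%R by rewrite in_itv.
have := cP _ xI; have := cP' _ xI.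
have := ler_norm (f c); have := ler_norm (- f c'); rewrite normrN ler_norml.
by have := normr_ge0 (f c); have := normr_ge0 (f c'); lra.
Qed.

Lemma within_continuous_oo_eq0 f a b : a < b ->
  {within `[a, b], continuous f} ->
  (forall x, a < x < b -> f x = 0) -> forall x, a <= x <= b -> f x = 0.
Proof.
move=> ab cf f0 x /andP[ax xb].
have [_ cr cl] := (continuous_within_itvP f ab).1 cf.
move: ax; rewrite le_eqVlt => /predU1P[<-|ax].
  suff H : f @ a^'+ --> (0 : R) by exact: (cvg_unique _ cr H).
  apply: cvg_near_cst.
  near=> z; apply: f0; apply/andP.
  by split; near: z; [exact: nbhs_right_gt|exact: nbhs_right_lt].
move: xb; rewrite le_eqVlt => /predU1P[->|xb]; last by rewrite f0 ?ax.
suff H : f @ b^'- --> (0 : R) by exact: (cvg_unique _ cl H).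
apply: cvg_near_cst.
near=> z; apply: f0; apply/andP.
by split; near: z; [exact: nbhs_left_gt|exact: nbhs_left_lt].
Unshelve. all: by end_near. Qed.

End Calculus.

(** * Square integrable solutions on a half-line *)

Section Halfline.
Context {R : realType}.
Implicit Types (f df : R -> R) (a x y z : R).

Lemma linear_bounded_le0 (c K : R) : (forall y, 0 <= y -> c * y <= K) -> c <= 0.
Proof.
move=> cK; rewrite leNgt; apply/negP => c0.
have K1 : 0 <= (`|K| + 1) / c.
  by rewrite divr_ge0 // ?addr_ge0 // ltW.
have := cK _ K1.
by rewrite mulrC divfK ?gt_eqF //; have := ler_norm K; lra.
Qed.

(** The integral of the square of f over [a, x] never exceeds its integral
over the half-line; by the fundamental theorem of calculus the former is the
increment of any primitive. The bound does not depend on the primitive. *)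
Lemma L2_primitive_bounded f a : 0 < a -> is_L2 `[0, +oo[ f ->
  (forall z, a <= z -> {for z, continuous f}) ->
  exists2 K : R, 0 <= K & forall F : R -> R,
    (forall z, a <= z -> is_derive z 1 F (f z ^+ 2)) ->
    forall x, a <= x -> F x - F a <= K.
Proof.
move=> a0 [mf L2f] cf.
set I := (\int[lebesgue_measure]_(x in `[0%R, +oo[) ((f x) ^+ 2)%:E)%E in L2f.
have I0 : (0 <= I)%E by apply: integral_ge0 => x _; rewrite lee_fin sqr_ge0.
have If : I \is a fin_num by rewrite ge0_fin_numE.
exists (fine I); first exact: fine_ge0.
move=> F FP x; rewrite le_eqVlt => /predU1P[<-|ax].
  by rewrite subrr fine_ge0.
have cF z : a <= z -> {for z, continuous F}.
  by move=> /FP [+ _] => /derivable1_diffP/differentiable_continuous.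
have := @continuous_FTC2 R (fun x => f x ^+ 2) F a x ax.
move=> FTC; rewrite -lee_fin fineK // EFinB -FTC.
- apply: ge0_subset_integral => //=.
  + apply/measurable_EFinP; apply: measurable_funX; exact: mf.
  + by move=> z _; rewrite lee_fin sqr_ge0.
  + by move=> z /=; rewrite !in_itv /= andbT => /andP[az _]; lra.
- apply/continuous_in_subspaceT => z /[!inE] /=; rewrite in_itv /= => /andP[az _].
  have cz : {for z, continuous f} by exact: cf.
  by apply: (@continuousM _ _ f f).
- split.
  + by move=> z; rewrite in_itv /= => /andP[az _]; have [] := FP z _; first lra.
  + by apply: cvg_at_right_filter; apply: cF.
  + by apply: cvg_at_left_filter; apply: cF; exact: ltW.
- move=> z; rewrite in_itv /= => /andP[az _].
  by rewrite derive1E; have [_ ->] := FP z (ltW az).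
Qed.

(** For l <= 0 the solutions of f'' = l f oscillate or are affine, so none
but 0 is square integrable. The conserved quantity c = f'^2 - l f^2 makes this
quantitative without solving the equation: if l < 0, a primitive of f^2 equals
c x / (- 2 l) up to a bounded term, so square integrability forces c = 0. *)
Lemma L2_halfline_eq0 f df (l : R) : l <= 0 ->
  (forall z, 0 < z -> is_derive z 1 f (df z)) ->
  (forall z, 0 < z -> is_derive z 1 df (l * f z)) ->
  is_L2 `[0, +oo[ f -> forall x, 0 < x -> f x = 0.
Proof.
move=> l0 fP dfP L2f a a0.
have cf z : a <= z -> {for z, continuous f}.
  move=> az.
  by have [/derivable1_diffP/differentiable_continuous] := fP z (lt_le_trans a0 az).
have [K K0 KP] := L2_primitive_bounded a0 L2f cf.
have pos x z : a <= z <= x -> 0 < z by case/andP=> az _; apply: lt_le_trans az.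
(* f'^2 - l f^2 is a first integral of f'' = l f *)
pose c := df a ^+ 2 - l * f a ^+ 2.
have cE x : a <= x -> df x ^+ 2 - l * f x ^+ 2 = c.
  move=> ax.
  apply: (@is_derive_eq0_cst _ (fun z => df z ^+ 2 - l * f z ^+ 2)
            (fun=> 0) a x ax) => // z /pos z0.
  have H1 := fP z z0; have H2 := dfP z z0; apply: is_derive_eq.
  by rewrite /GRing.scale /=; ring.
move: l0; rewrite le_eqVlt => /predU1P[l0|l0]; last first.
  (* as (f f')' = f'^2 + l f^2 = c + 2 l f^2, this F is a primitive of f^2 *)
  pose F x := (c * x - f x * df x) / (- 2 * l).
  have FP z : a <= z -> is_derive z 1 F (f z ^+ 2).
    move=> az; have z0 := lt_le_trans a0 az.
    have H1 := fP z z0; have H2 := dfP z z0; rewrite /F; apply: is_derive_eq.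
    rewrite /GRing.scale /= -(cE z az); field.
    by rewrite lt_eqF.
  suff c0 : c <= 0.
    have := sqr_ge0 (df a); have := sqr_ge0 (f a); rewrite /c in c0 => ? ?.
    by apply/eqP; rewrite -sqrf_eq0; apply/eqP; nra.
  apply: (@linear_bounded_le0 _ (- 2 * l * K + c + c / - l)) => y y0.
  have ay : a <= a + y by lra.
  have := KP F FP _ ay; rewrite /F -mulrBl ler_pdivrMr; last by nra.
  (* by conservation of c, both f and f' are bounded, hence so is f f' *)
  have B z : a <= z -> `|f z * df z| <= (c + c / - l) / 2.
    move=> /cE E.
    have f2 : f z ^+ 2 <= c / - l.
      rewrite ler_pdivlMr ?oppr_gt0 //; have := sqr_ge0 (df z); lra.
    have d2 : df z ^+ 2 <= c by have := sqr_ge0 (f z); nra.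
    have := sqr_ge0 (f z - df z); have := sqr_ge0 (f z + df z).
    by rewrite ler_norml => ? ?; apply/andP; split; lra.
  have := B _ (lexx a); have := B _ ay; rewrite !ler_norml; lra.
subst l.
(* for l = 0 the function is affine, and a nonzero affine function is not in L2 *)
have dE x : a <= x -> df x = df a.
  move=> ax; apply: (@is_derive_eq0_cst _ df (fun=> 0) a x ax) => // z /pos z0.
  by have := dfP z z0; rewrite mul0r.
have fE x : a <= x -> f x = f a + df a * (x - a).
  move=> ax; apply/eqP; rewrite -subr_eq; apply/eqP.
  have := @is_derive_eq0_cst _ (fun z => f z - df a * (z - a))
     (fun z => df z - df a) a x ax.
  rewrite subrr mulr0 subr0; apply => z zI.
    have H1 := fP z (pos _ _ zI); apply: is_derive_eq.
    by rewrite /GRing.scale /=; ring.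
  by rewrite dE ?subrr //; case/andP: zI.
(* the primitive of (f a + df a * y)^2 vanishing at 0, as a sum of squares *)
pose F y := y * ((f a + df a * y / 2) ^+ 2 + df a ^+ 2 * y ^+ 2 / 12).
have FK y : 0 <= y -> F y <= K.
  move=> y0; have ay : a <= a + y by lra.
  have := KP (fun x => F (x - a)) _ _ ay.
  have F0 : F 0 = 0 by rewrite /F mul0r.
  rewrite subrr F0 subr0 [a + y]addrC addrK; apply => z az.
  rewrite fE // /F; apply: is_derive_eq.
  by rewrite /GRing.scale /=; field.
have d0 : df a = 0.
  apply/eqP; rewrite -sqrf_eq0 eq_le sqr_ge0 andbT.
  apply: (@linear_bounded_le0 _ (12 * K + df a ^+ 2)) => y y0.
  have A2 := sqr_ge0 (f a + df a * y / 2); have d2 := sqr_ge0 (df a).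
  have [y1|/ltW y1] := leP y 1.
    by have := @mulr_ge0 R (df a ^+ 2) (1 - y) d2; rewrite subr_ge0 => /(_ y1); lra.
  have H := FK y y0; rewrite /F in H.
  have H1 : 0 <= y * (f a + df a * y / 2) ^+ 2 by rewrite mulr_ge0.
  have H2 : 0 <= df a ^+ 2 * y * (y ^+ 2 - 1).
    apply: (mulr_ge0 (mulr_ge0 d2 y0)); nra.
  lra.
apply/eqP; rewrite -sqrf_eq0 eq_le sqr_ge0 andbT.
apply: (@linear_bounded_le0 _ K) => y /FK; rewrite /F d0 !mul0r expr0n /= !mul0r; lra.
Qed.
End Halfline.

(** * Vanishing of a bound state on one edge *)

Section Edges.
Context {R : realType} (G : metric_graph R).
Implicit Types (u : edge G -> R -> complex R).

(** The coefficient q is real: the real and the imaginary part of a solution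
satisfy one and the same real linear equation, whose coefficient depends on the
solution only through its modulus. *)
Lemma nls_components (p lambda : R) u e x :
  nls_equation p lambda u -> interior (edge_dom e) x ->
  let q := lambda - kappa e * ComplexField.Normc.normc (u e x) `^ (p - 2) in
  [/\ is_derive x 1 (re (u e)) (derive1 (re (u e)) x),
      is_derive x 1 (derive1 (re (u e))) (q * re (u e) x),
      is_derive x 1 (im (u e)) (derive1 (im (u e)) x) &
      is_derive x 1 (derive1 (im (u e))) (q * im (u e) x)].
Proof.
move=> nls xe q; have [[d1 d2] [d3 d4] E] := nls e x xe.
have [E1 E2] : derive1 (derive1 (re (u e))) x = q * re (u e) x /\
               derive1 (derive1 (im (u e))) x = q * im (u e) x.
  move: E; rewrite /q /re /im /deriveC /=; case: (u e x) => a b /=.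
  move=> [E1 E2]; rewrite !mul0r !subr0 in E1; rewrite !mul0r !addr0 in E2.
  by split; [rewrite mulrBl -E1 addrK|
             rewrite mulrBl -E2 addrK].
have mk (f : R -> R) d :
    derivable f x 1 -> derive1 f x = d -> is_derive x 1 f d.
  by move=> df <-; split=> //; rewrite derive1E.
by split; [exact: mk d1 erefl|exact: mk d3 E1|exact: mk d2 erefl|exact: mk d4 E2].
Qed.

Lemma hline_eq0 (p lambda : R) u (h : hline G) : lambda <= 0 ->
  nls_equation p lambda u -> continuousC_on (edge_dom (inr h)) (u (inr h)) ->
  is_H1C (edge_dom (inr h)) (u (inr h)) ->
  forall x, 0 <= x -> u (inr h) x = 0.
Proof.
move=> l0 nls [cre cim] [[L2re _] [L2im _]] x x0.
have int z : 0 < z -> interior (edge_dom (inr h)) z.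
  by move=> z0; rewrite interior_itv_bndy /= in_itv /= z0.
have sub : `[0, x + 1] `<=` edge_dom (inr h).
  by move=> z /=; rewrite !in_itv /= andbT => /andP[].
have pos z : 0 < z -> re (u (inr h)) z = 0 /\ im (u (inr h)) z = 0.
  move=> z0; split.
    apply: (@L2_halfline_eq0 _ _ (derive1 (re (u (inr h)))) _ l0 _ _ L2re z z0) => y y0.
      by have [] := nls_components nls (int y y0).
    by have [_ + _ _] := nls_components nls (int y y0); rewrite /= mul0r subr0.
  apply: (@L2_halfline_eq0 _ _ (derive1 (im (u (inr h)))) _ l0 _ _ L2im z z0) => y y0.
    by have [_ _ + _] := nls_components nls (int y y0).
  by have [_ _ _] := nls_components nls (int y y0); rewrite /= mul0r subr0.
have x1 : 0 < x + 1 by lra.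
have xI : 0 <= x <= x + 1 by lra.
have re0 : re (u (inr h)) x = 0.
  apply: (within_continuous_oo_eq0 x1 (continuous_subspaceW sub cre) _ xI).
  by move=> z /andP[/pos[]].
have im0 : im (u (inr h)) x = 0.
  apply: (within_continuous_oo_eq0 x1 (continuous_subspaceW sub cim) _ xI).
  by move=> z /andP[/pos[]].
by apply/eqP; rewrite eq_complex; move: re0 im0; rewrite /re /im => -> ->;
  rewrite !eqxx.
Qed.

Lemma right_derivative_eq0 (v : R -> complex R) a b d : a < b ->
  (forall x, a <= x <= b -> v x = 0) -> right_derivative v a d -> d = 0.
Proof.
move=> ab v0 [dre dim].
have near0 (g : complex R -> R) : g 0 = 0 ->
    (fun h => (g (v (a + h)) - g (v a)) / h) @ 0^'+ --> (0 : R).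
  move=> g0; apply: cvg_near_cst.
  near=> h; rewrite !v0 ?g0 ?subrr ?mul0r //.
    by rewrite lexx ltW.
  have h0 : 0 < h by near: h; exact: nbhs_right_gt.
  have hb : h < b - a by near: h; apply: nbhs_right_lt; rewrite subr_gt0.
  lra.
have E1 := cvg_unique _ dre (near0 (@complex.Re R) erefl).
have E2 := cvg_unique _ dim (near0 (@complex.Im R) erefl).
by apply/eqP; rewrite eq_complex E1 ?E2 ?eqxx.
Unshelve. all: by end_near. Qed.

Lemma left_derivative_eq0 (v : R -> complex R) a b d : a < b ->
  (forall x, a <= x <= b -> v x = 0) -> left_derivative v b d -> d = 0.
Proof.
move=> ab v0 [dre dim].
have near0 (g : complex R -> R) : g 0 = 0 ->
    (fun h => (g (v (b + h)) - g (v b)) / h) @ 0^'- --> (0 : R).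
  move=> g0; apply: cvg_near_cst.
  near=> h; rewrite !v0 ?g0 ?subrr ?mul0r //.
    by rewrite lexx ltW.
  have h0 : h < 0 by near: h; exact: nbhs_left_lt.
  have hb : a - b < h by near: h; apply: nbhs_left_gt; rewrite subr_lt0.
  lra.
have E1 := cvg_unique _ dre (near0 (@complex.Re R) erefl).
have E2 := cvg_unique _ dim (near0 (@complex.Im R) erefl).
by apply/eqP; rewrite eq_complex E1 ?E2 ?eqxx.
Unshelve. all: by end_near. Qed.

(** Since p > 2, the modulus to the power p - 2 is bounded on the compact edge,
so the nonlinear equation is a linear one with bounded coefficient and Cauchy
uniqueness applies to each component. *)
Lemma bedge_eq0 (p lambda c : R) u (b : bedge G) : 2 < p ->
  nls_equation p lambda u -> continuousC_on (edge_dom (inl b)) (u (inl b)) ->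
  u (inl b) c = 0 ->
  (c = 0 /\ right_derivative (u (inl b)) c 0 \/
   c = len b /\ left_derivative (u (inl b)) c 0) ->
  forall x, 0 <= x <= len b -> u (inl b) x = 0.
Proof.
move=> p2 nls [cre cim] uc0 flat x xI; have l0 := len_gt0 b.
have int z : 0 < z < len b -> interior (edge_dom (inl b)) z.
  by move=> z0; rewrite interior_itv_bnd /= in_itv /= z0.
have [B1 B10 B1P] := within_continuous_bounded (ltW l0) cre.
have [B2 B20 B2P] := within_continuous_bounded (ltW l0) cim.
pose C := `|lambda| + (Num.sqrt (B1 ^+ 2 + B2 ^+ 2)) `^ (p - 2).
have C0 : 0 <= C by rewrite addr_ge0 ?powR_ge0.
have qC z : 0 < z < len b ->
    `|lambda - 1 * ComplexField.Normc.normc (u (inl b) z) `^ (p - 2)| <= C.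
  move=> /andP[/ltW z0 /ltW zl]; rewrite mul1r.
  apply: (le_trans (ler_normB _ _)); rewrite lerD2l ger0_norm ?powR_ge0 //.
  have [] : `|re (u (inl b)) z| <= B1 /\ `|im (u (inl b)) z| <= B2.
    by split; [apply: B1P|apply: B2P]; rewrite z0.
  rewrite /re /im /ComplexField.Normc.normc; case: (u (inl b) z) => s t /= sB tB.
  apply: ge0_ler_powR; rewrite ?nnegrE ?sqrtr_ge0 ?subr_ge0 ?(ltW p2) //.
  apply: ler_wsqrtr.
  rewrite -(real_normK (num_real s)) -(real_normK (num_real t)).
  by apply: lerD; rewrite lerXn2r ?nnegrE.
have cE : c = 0 \/ c = len b by case: flat => -[]; [left|right].
(* g stands for the real or the imaginary part *)
have part (g : complex R -> R) (f := fun z => g (u (inl b) z)) : g 0 = 0 ->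
    {within edge_dom (inl b), continuous f} ->
    (forall z, 0 < z < len b -> is_derive z 1 f (derive1 f z) /\
      is_derive z 1 (derive1 f)
        ((lambda - 1 * ComplexField.Normc.normc (u (inl b) z) `^ (p - 2)) *
         f z)) ->
    (c = 0 /\ (fun h => (f (c + h) - f c) / h) @ 0^'+ --> (0 : R) \/
     c = len b /\ (fun h => (f (c + h) - f c) / h) @ 0^'- --> (0 : R)) ->
    f x = 0.
  move=> g0 cf fP flatf.
  have fc0 : f c = 0 by rewrite /f uc0.
  apply: (within_continuous_oo_eq0 l0 cf _ xI).
  apply: (@small_energy_eq0 _ f (derive1 f) _ C _ _ C0) => [z|z|z|].
  - by move=> /fP[].
  - by move=> /fP[_]; apply.
  - by move=> zI; rewrite normrM ler_wpM2r ?qC.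
  - apply: (energy_small_at_end l0 cf _ cE fc0) => [z /fP[+ _] //|d d0].
    case: flatf => -[c0 lim].
      have [r r0 rP] := right_derivative_flat fc0 lim d0.
      by exists r => // z /andP[z0 _]; apply: rP; rewrite ?c0.
    have [r r0 rP] := left_derivative_flat fc0 lim d0.
    by exists r => // z /andP[_ z0]; apply: rP; rewrite c0.
have re0 : complex.Re (u (inl b) x) = 0.
  apply: (part (@complex.Re R)) => // [z /int zI|].
    by have [] := nls_components nls zI.
  by case: flat => -[? [? ?]]; [left|right].
have im0 : complex.Im (u (inl b) x) = 0.
  apply: (part (@complex.Im R)) => // [z /int zI|].
    by have [_ _] := nls_components nls zI.
  by case: flat => -[? [? ?]]; [left|right].
by apply/eqP; rewrite eq_complex re0 im0 !eqxx.
Qed.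

End Edges.

(** * Leaves of a subset of the edges of a tree *)

Section Trees.
Context {R : realType} (G : metric_graph R).
Implicit Types (N : pred (bedge G)) (d : dart G) (s : seq (dart G)).

Definition incident (e : bedge G) (v : vertex G) :=
  (source e == v) || (target e == v).

Definition rev_dart d : dart G := (d.1, ~~ d.2).

Lemma dart_from_rev_dart d : dart_from (rev_dart d) = dart_to d.
Proof. by case: d => e []. Qed.

Lemma dart_to_rev_dart d : dart_to (rev_dart d) = dart_from d.
Proof. by case: d => e []. Qed.

Lemma incident_dart e v : incident e v -> exists2 d, d.1 = e & dart_from d = v.
Proof. by case/orP=> /eqP <-; [exists (e, false)|exists (e, true)]. Qed.

Lemma dart_to_incident d : incident d.1 (dart_to d).
Proof. by case: d => e []; rewrite /incident /dart_to /= eqxx ?orbT. Qed.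

Lemma incident_ends d v : incident d.1 v -> v = dart_from d \/ v = dart_to d.
Proof.
by case: d => e []; rewrite /incident /dart_from /dart_to /= => /orP[]/eqP; auto.
Qed.

Definition dart_link : rel (dart G) := fun d d' => dart_to d == dart_from d'.

Lemma tree_no_loop d : is_tree G -> dart_to d != dart_from d.
Proof.
move=> tree; apply/negP => loop; have := tree [:: d].
by rewrite /is_cycle /= /dart_link loop.
Qed.

(** If the end of the last dart were an earlier vertex of the path, the part of
the path from that vertex on would be a cycle. *)
Lemma tree_path_end_notin d s : is_tree G -> path dart_link d s ->
  uniq [seq dart_from x | x <- d :: s] -> uniq [seq x.1 | x <- d :: s] ->
  dart_to (last d s) \notin [seq dart_from x | x <- d :: s].
Proof.
move=> tree ps uV uE; apply/negP => /mapP[y ys yE].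
have [s1 [s2 sE]] : exists s1 s2, d :: s = s1 ++ y :: s2.
  by case/splitPr: ys => s1 s2; exists s1, s2.
have := tree (y :: s2); rewrite /is_cycle /=.
have lastE : last y s2 = last d s by rewrite -[RHS](last_cons d) sE last_cat.
have -> : path dart_link y (rcons s2 y).
  rewrite rcons_path lastE /dart_link yE eqxx andbT.
  case: s1 sE => [[<- <-] //|z s1 [_ sE]].
  by move: ps; rewrite sE cat_path /= => /and3P[].
move: uV uE; rewrite sE !map_cat !cat_uniq /=.
by move=> /and3P[_ _ ->] /and3P[_ _ ->].
Qed.

(** The vertices of a path are listed as the starting points of its darts: the
end of the last dart is left out, so that a path may also close up into a
cycle. *)
Definition simple_path N d s :=
  [&& path dart_link d s, all (fun x => N x.1) (d :: s),
    uniq [seq dart_from x | x <- d :: s] & uniq [seq x.1 | x <- d :: s]].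

Lemma simple_path_extend N d s e : is_tree G -> simple_path N d s ->
  N e -> incident e (dart_to (last d s)) -> e != (last d s).1 ->
  exists d', simple_path N d (rcons s d').
Proof.
move=> tree /and4P[ps aN uV uE] Ne inc neq.
have end_new := tree_path_end_notin tree ps uV uE.
have [d' d'e d'v] := incident_dart inc; exists d'; apply/and4P; split.
- by rewrite rcons_path ps /dart_link d'v eqxx.
- by rewrite -rcons_cons all_rcons aN d'e Ne.
- by rewrite -rcons_cons map_rcons rcons_uniq uV d'v end_new.
rewrite -rcons_cons map_rcons rcons_uniq uE d'e andbT.
apply/negP => /mapP[y ys ey]; move/negP: end_new; apply.
(* an edge of the path other than the last one has both ends among the
   starting points of the darts of the path *)
have [s1 [s2 sE]] : exists s1 s2, d :: s = s1 ++ y :: s2.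
  by case/splitPr: ys => s1 s2; exists s1, s2.
have lastE : last y s2 = last d s by rewrite -[RHS](last_cons d) sE last_cat.
have [->|->] :
    dart_to (last d s) = dart_from y \/ dart_to (last d s) = dart_to y.
- by apply: incident_ends; rewrite -ey.
- exact: map_f.
case: s2 sE lastE => [_ /= lastE|z s2 sE _]; first by rewrite ey lastE eqxx in neq.
have /eqP -> : dart_link y z.
  case: s1 sE => [[<- sE]|x s1 [_ sE]]; first by move: ps; rewrite sE /= => /andP[].
  by move: ps; rewrite sE cat_path /= => /and4P[].
by rewrite map_f // sE mem_cat !inE eqxx !orbT.
Qed.

(** In a tree a path inside N can be prolonged as long as its end meets another
edge of N, and its length is at most the number of edges, so it ends at a
vertex meeting a single edge of N. Prescribing the first dart d is what later
allows to keep away from a given vertex. *)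
Lemma tree_leaf N d : is_tree G -> N d.1 -> exists2 s, simple_path N d s &
  forall e, N e -> incident e (dart_to (last d s)) -> e = (last d s).1.
Proof.
move=> tree Nd.
have [n] := ubnP (#|bedge G| - size (Nil (dart G)))%N.
have : simple_path N d [::] by rewrite /simple_path /= Nd.
elim: n [::] => // n IHn s Ps; rewrite ltnS => sn.
have [leaf|] := pselect (forall e, N e -> incident e (dart_to (last d s)) ->
                                   e = (last d s).1); first by exists s.
move=> /existsNP[e /not_implyP[Ne /not_implyP[inc /eqP neq]]].
have [d' Ps'] := simple_path_extend tree Ps Ne inc neq.
apply: (IHn _ Ps'); apply: leq_trans sn; rewrite size_rcons.
apply: ltn_sub2l => //.
case/and4P: Ps => _ _ _ /card_uniqP; rewrite size_map /= => <-.
exact: max_card.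
Qed.

Lemma degree_ge v :
  (#|[set e' | incident e' v]%SET| + #|[set h : hline G | base h == v]%SET|
    <= degree v)%N.
Proof.
rewrite /degree leq_add2r.
apply: leq_trans (leq_card_setU _ _); apply: eq_leq; apply: eq_card => e'.
by rewrite !inE.
Qed.

Lemma degree1_edge e e' v : incident e v -> incident e' v -> degree v = 1%N ->
  e' = e.
Proof.
move=> inc inc' deg; apply/eqP; apply: contraT => neq.
have := degree_ge v; rewrite deg leqNgt; case/negP.
apply: (@leq_trans #|[set e'; e]%SET|); first by rewrite cards2 neq.
apply: leq_trans (leq_addr _ _); apply: subset_leq_card.
by apply/fintype.subsetP => x; rewrite !inE => /orP[]/eqP ->.
Qed.

Lemma degree1_hline e v (h : hline G) : incident e v -> degree v = 1%N ->
  base h != v.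
Proof.
move=> inc deg; apply/negP => hv.
have := degree_ge v; rewrite deg leqNgt; case/negP.
rewrite -addn1 leq_add // card_gt0; apply/set0Pn; [exists e|exists h];
  by rewrite inE.
Qed.

Lemma degree1I d : is_tree G ->
  (forall e, incident e (dart_to d) -> e = d.1) ->
  (forall h : hline G, base h != dart_to d) -> degree (dart_to d) = 1%N.
Proof.
move=> tree uniq_e no_h; set v := dart_to d.
rewrite /degree -cardsUI.
have -> : [set e : bedge G | source e == v]%SET :|:
    [set e : bedge G | target e == v]%SET = [set d.1]%SET.
  apply/setP => e; rewrite !inE; apply/idP/eqP => [/uniq_e //|->].
  exact: dart_to_incident.
have -> : [set e : bedge G | source e == v]%SET :&:
    [set e : bedge G | target e == v]%SET = finset.set0.
  apply/setP => e; rewrite !inE; apply/negP => /andP[/eqP es /eqP et].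
  have := tree_no_loop (e, false) tree.
  by rewrite /dart_to /dart_from /= es et eqxx.
have -> : [set h : hline G | base h == v]%SET = finset.set0.
  by apply/setP => h; rewrite !inE (negbTE (no_h h)).
by rewrite cards1 !cards0.
Qed.

Lemma pendant_dart d : degree (dart_to d) = 1%N -> pendant d.1.
Proof.
by case: d => e []; rewrite /pendant /dart_to /= => ->; rewrite ?orbT.
Qed.

(** An edge with two ends of degree one is a connected component by itself, and
a half-line has no vertex left to be attached to. *)
Lemma single_edge_compact d : degree (dart_from d) = 1%N ->
  degree (dart_to d) = 1%N -> ~ noncompact G.
Proof.
move=> deg_from deg_to /card_gt0P[h _].
have inc_from : incident d.1 (dart_from d).
  by rewrite -dart_to_rev_dart; exact: (dart_to_incident (rev_dart d)).
have inc_to := dart_to_incident d.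
suff [bh|bh] : base h = dart_from d \/ base h = dart_to d.
- by have := degree1_hline h inc_from deg_from; rewrite bh eqxx.
- by have := degree1_hline h inc_to deg_to; rewrite bh eqxx.
have /connectP[p] := connected_graph (dart_from d) (base h).
suff H v q : v = dart_from d \/ v = dart_to d ->
    path (fun x y => [exists e : bedge G,
      ((source e == x) && (target e == y))
      || ((source e == y) && (target e == x))]) v q ->
    last v q = dart_from d \/ last v q = dart_to d.
  by move=> pth ->; apply: H pth; left.
elim: q v => [//|w q IHq] v vE /= /andP[/existsP[e eE]]; apply: IHq.
have [ev ew] : incident e v /\ incident e w.
  by rewrite /incident; case/orP: eE => /andP[-> ->]; rewrite ?orbT.
apply: incident_ends; suff <- : e = d.1 by [].
by case: vE ev => -> ev;
  [exact: degree1_edge ev deg_from|exact: degree1_edge ev deg_to].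
Qed.

End Trees.

(** * Propagation of the zero set through the tree *)

Section BoundState.
Context {R : realType} (G : metric_graph R).
Implicit Types (u : edge G -> R -> complex R).

Definition zero_on u (e : edge G) := forall x, edge_dom e x -> u e x = 0.

Lemma zero_on_hlineE u (h : hline G) :
  zero_on u (inr h) <-> forall x, 0 <= x -> u (inr h) x = 0.
Proof.
by split=> u0 x xI; apply: u0; move: xI; rewrite /= in_itv /= andbT.
Qed.

Lemma zero_on_bedgeE u (b : bedge G) :
  zero_on u (inl b) <-> forall x, 0 <= x <= len b -> u (inl b) x = 0.
Proof.
by split=> u0 x xI; apply: u0; move: xI; rewrite /= in_itv.
Qed.

(** At a vertex where all incident edges but one carry the zero function, and
there is such an edge, continuity gives the value 0 and the Kirchhoff condition, in which a single
term survives, gives the outgoing derivative 0: these are zero Cauchy data for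
the remaining edge. *)
Lemma kirchhoff_leaf_eq0 (p lambda : R) u (d : dart G) : 2 < p ->
  is_tree G -> continuous_on_graph u -> nls_equation p lambda u ->
  kirchhoff u -> (forall h : hline G, zero_on u (inr h)) ->
  (forall b, incident b (dart_to d) -> b != d.1 -> zero_on u (inl b)) ->
  (exists2 b, b != d.1 & incident b (dart_to d)) \/
    (exists h : hline G, base h = dart_to d) ->
  zero_on u (inl d.1).
Proof.
move=> p2 tree [cu [U [Us Ut Uh]]] nls [d0 [d1 [d0P d1P sum0]]] h0 b0 other.
set v := dart_to d.
have Uv0 : U v = 0.
  case: other => [[b bd bv]|[h hv]].
    have /zero_on_bedgeE bz := b0 b bv bd; have l0 := len_gt0 b.
    by case/orP: bv => /eqP bv; rewrite /v -bv -?Us -?Ut bz // lexx ltW.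
  by have /zero_on_hlineE hz := h0 h; rewrite /v -hv -Uh hz.
have d0h h : d0 (inr h) = 0.
  have /zero_on_hlineE hz := h0 h.
  by apply: (right_derivative_eq0 ltr01 _ (d0P _)) => x /andP[x0 _]; apply: hz.
have d0b b : source b == v -> b != d.1 -> d0 (inl b) = 0.
  move=> bv bd; have /zero_on_bedgeE bz : zero_on u (inl b).
    by apply: b0 => //; rewrite /incident bv.
  exact: (right_derivative_eq0 (len_gt0 b) bz (d0P _)).
have d1b b : target b == v -> b != d.1 -> d1 b = 0.
  move=> bv bd; have /zero_on_bedgeE bz : zero_on u (inl b).
    by apply: b0 => //; rewrite /incident bv orbT.
  exact: (left_derivative_eq0 (len_gt0 b) bz (d1P _)).
have vcore : in_core v by apply/existsP; exists d.1; exact: dart_to_incident.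
have := sum0 v vcore; rewrite [X in _ + X]big1 // addr0 => {}sum0.
have noloop := tree_no_loop d tree.
apply/zero_on_bedgeE.
move: Uv0 d0b d1b sum0 noloop; rewrite /v /dart_to /dart_from {b0 other v vcore}.
case: d => e [] /= Uv0 d0b d1b sum0 noloop.
  rewrite (bigD1 e) //= big1 ?addr0 in sum0; last first.
    by move=> b /andP[bv be]; exact: d0b.
  rewrite big1 ?addr0 in sum0; last first.
    move=> b bv; rewrite d1b ?oppr0 //; apply: contraNneq noloop => be.
    by rewrite -(eqP bv) be.
  apply: (bedge_eq0 (c := 0) p2 nls (cu _)); first by rewrite Us.
  by left; split=> //; rewrite -sum0.
rewrite big1 ?add0r in sum0; last first.
  move=> b bv; rewrite d0b //; apply: contraNneq noloop => be.
  by rewrite -(eqP bv) be.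
rewrite (bigD1 e) //= big1 ?addr0 in sum0; last first.
  by move=> b /andP[bv be]; rewrite d1b ?oppr0.
apply: (bedge_eq0 (c := len e) p2 nls (cu _)); first by rewrite Ut.
by right; split=> //; move/eqP: sum0; rewrite oppr_eq0 => /eqP <-.
Qed.

Lemma mass_eq0 u : (forall e, zero_on u e) -> mass u = 0%E.
Proof.
move=> u0; rewrite /mass big1 // => e _.
rewrite (eq_integral (cst 0%E)) ?integral0 // => x.
rewrite inE => /u0 ->.
by rewrite /ComplexField.Normc.normc /= expr0n /= addr0 sqrtr0 expr0n.
Qed.

(** If u is nonzero on some bounded edge, every leaf of the forest of these
edges is a vertex of degree one of the graph, since otherwise the vanishing at
that leaf would propagate. A path in the forest from one leaf to another has a
pendant at each end; these coincide when there is only one, so the graph would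
be a single edge. To get such a path, start at a vertex of degree one if there
is one in the forest; there is, as the end of any maximal path is one. *)
Lemma zero_on_bedges u : is_tree G -> noncompact G ->
  (#|[set b : bedge G | pendant b]%SET| <= 1)%N ->
  (forall d : dart G,
    (forall b, incident b (dart_to d) -> b != d.1 -> zero_on u (inl b)) ->
    (exists2 b, b != d.1 & incident b (dart_to d)) \/
      (exists h : hline G, base h = dart_to d) ->
    zero_on u (inl d.1)) ->
  forall b, zero_on u (inl b).
Proof.
move=> tree noncomp pend leaf_eq0 b0; apply/not_notP => b0N.
pose N b := ~~ `[< zero_on u (inl b) >].
have NP b : reflect (~ zero_on u (inl b)) (N b) by apply: (iffP negP) => H /asboolP.
have leaf_degree (d : dart G) : N d.1 ->
    (forall e, N e -> incident e (dart_to d) -> e = d.1) ->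
    degree (dart_to d) = 1%N.
  move=> /NP Nd only.
  have zero b : incident b (dart_to d) -> b != d.1 -> zero_on u (inl b).
    by move=> bv /eqP bd; apply/not_notP => /NP Nb; apply: bd; exact: only.
  apply: degree1I => // [e ev|h].
    apply/eqP; apply: contraT => ed; exfalso; apply: Nd.
    by apply: leaf_eq0 => //; left; exists e.
  apply/negP => /eqP hv; apply: Nd.
  by apply: leaf_eq0 => //; right; exists h.
have pendant_eq (b b' : bedge G) : pendant b -> pendant b' -> b = b'.
  move=> pb pb'; apply/eqP; apply: contraT => neq.
  move: pend; rewrite leqNgt; case/negP.
  apply: (@leq_trans #|[set b; b']%SET|); first by rewrite cards2 neq.
  apply: subset_leq_card.
  by apply/fintype.subsetP => x; rewrite !inE => /orP[]/eqP ->.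
have [d Nd dP] : exists2 d : dart G, N d.1 &
    forall d' : dart G, N d'.1 -> degree (dart_from d') = 1%N ->
      degree (dart_from d) = 1%N.
  have [[d [Nd d1]]|none] :=
      pselect (exists d : dart G, N d.1 /\ degree (dart_from d) = 1%N).
    by exists d.
  exists (b0, false) => [|d' Nd' d'1]; first exact/NP.
  by case: none; exists d'.
have [s sP leaf] := tree_leaf tree Nd.
set d' := last d s in leaf.
have Nd' : N d'.1.
  by case/and4P: sP => _ /allP aN _ _; apply: aN; exact: mem_last.
have deg' := leaf_degree d' Nd' leaf.
have deg : degree (dart_from d) = 1%N.
  by apply: (dP (rev_dart d') Nd'); rewrite dart_from_rev_dart.
(* both ends of the path are pendants, and no edge occurs twice in the path *)
have E : d.1 = d'.1.
  apply: pendant_eq; last exact: pendant_dart.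
  by apply: (@pendant_dart _ _ (rev_dart d)); rewrite dart_to_rev_dart.
case/and4P: sP => _ _ _; rewrite /= => /andP[].
have [s0 _ _|s0] := eqVneq s [::].
  by apply: (single_edge_compact deg _ noncomp); move: deg'; rewrite /d' s0.
case/negP; rewrite E /d'; case/lastP: s s0 {leaf d' Nd' deg' E} => // s y _.
by rewrite last_rcons map_f // mem_rcons mem_head.
Qed.

End BoundState.

Theorem theorem3p5 (R : realType) (G : metric_graph R) :
  is_tree G -> noncompact G -> core_nonempty G ->
  (#|[set b : bedge G | pendant b]%SET| <= 1)%N ->
  forall p mu : R, 2 < p -> 0 < mu ->
  ~ exists (u : edge G -> R -> complex R) (lambda : R),
      bound_state p mu lambda u /\ lambda <= 0.
Proof.
move=> tree noncomp _ pend p mu p2 mu0 [u [l [[[[cu H1u] massu] nls kir] l0]]].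
have h0 (h : hline G) : zero_on u (inr h).
  by apply/zero_on_hlineE; apply: (hline_eq0 l0 nls (cu.1 _) (H1u _)).
have b0 : forall b, zero_on u (inl b).
  by apply: zero_on_bedges => // d; exact: (kirchhoff_leaf_eq0 p2 tree cu nls kir h0).
have : mass u = 0%E by apply: mass_eq0 => -[b|h].
rewrite massu => /eqP; rewrite eqe => /eqP muE.
by rewrite muE ltxx in mu0.
Qed.
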